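(* Let $G$ be a connected directed graph with infinitely many vertices. Then there exists a bounded derivation on $\mathcal{A}_G$ which is not inner (i.e. is not of the form $\delta_T$ with $T\in\mathcal{A}_G$).
   Context: A directed graph $G=(\mathcal{V},\mathcal{E},s,r)$ has a vertex set $\mathcal{V}$ and an edge set $\mathcal{E}$ (each of arbitrary cardinality; loops and multiple edges allowed) and source and range maps $s,r\colon\mathcal{E}\to\mathcal{V}$; an edge $e$ is an arrow from $s(e)$ to $r(e)$. Connectedness refers to the underlying undirected graph. $\mathbb{F}_G^+$ is the set of all directed paths of finite length: vertices $v$ are paths of length $0$ with $r(v)=s(v)=v$, and a path of length $n\geq1$ is $p=e_1e_2\cdots e_n$ with $s(e_j)=r(e_{j+1})$, $r(p)=r(e_1)$, $s(p)=s(e_n)$; if $s(p_1)=r(p_2)$, the product $p_1p_2$ is the concatenation. Let $\mathcal{H}_G=\ell^2(\mathbb{F}_G^+)$ with orthonormal basis $\{\xi_w\}$. For $e\in\mathcal{E}$, $L_e\xi_w=\xi_{ew}$ if $r(w)=s(e)$ and $0$ otherwise; for $x\in\mathcal{V}$, $L_x\xi_w=\xi_w$ if $r(w)=x$ and $0$ otherwise. $\mathcal{A}_G$ is the norm-closed algebra generated by $\{L_e,L_x\colon e\in\mathcal{E},x\in\mathcal{V}\}$ in $B(\mathcal{H}_G)$. A derivation on $\mathcal{A}_G$ is a linear map $\delta\colon\mathcal{A}_G\to\mathcal{A}_G$ with $\delta(AB)=\delta(A)B+A\delta(B)$; $\delta_T(A)=AT-TA$. *)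

(* Defs.v *)
From HB Require Import structures.
From Stdlib Require Import Relations.
From mathcomp Require Import all_boot all_order all_algebra complex.
From mathcomp Require Import mathcomp_extra boolp classical_sets functions.
From mathcomp Require Import cardinality fsbigop reals ereal esum.
From mathcomp Require Import topology normedtype.

Set Implicit Arguments.
Unset Strict Implicit.
Unset Printing Implicit Defensive.

From mathcomp Require Import ring lra.

Import Order.TTheory GRing.Theory Num.Theory.

Local Open Scope classical_set_scope.
Local Open Scope complex_scope.
Local Open Scope ring_scope.

Local Notation normc := Normc.normc.

Record digraph := Digraph {
  vertex : Type;
  edge : Type;
  src : edge -> vertex;
  rng : edge -> vertex }.

Section Paths.
Variable G : digraph.
Implicit Types (v x : vertex G) (e : edge G).

Definition adjacent v w := exists e, src e = v /\ rng e = w.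

Definition graph_connected :=
  forall v w, clos_refl_sym_trans (vertex G) adjacent v w.

(* [composable v [:: e1; ...; en]] states that r(e1) = v and that
   s(ej) = r(e(j+1)) for 1 <= j < n. *)
Fixpoint composable v (es : seq (edge G)) : Prop :=
  if es is e :: es' then rng e = v /\ composable (src e) es' else True.

(* A path is stored together with its range, so that the vertex v, as a path of
   length 0, is the pair of v and the empty sequence. *)
Record fpath := FPath {
  prng : vertex G;
  pedges : seq (edge G);
  pcomposable : composable prng pedges }.

Lemma fpath_inj (u w : fpath) :
  prng u = prng w -> pedges u = pedges w -> u = w.
Proof.
case: u w => [v es h] [v' es' h'] /= e1 e2.
by subst v' es'; congr FPath; exact: Prop_irrelevance.
Qed.

Definition vpath v : fpath := @FPath v [::] I.

Lemma econs_subproof e (w : fpath) (h : prng w = src e) :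
  composable (rng e) (e :: pedges w).
Proof. by split=> //; rewrite -h; exact: pcomposable. Qed.

Definition econs e w h : fpath := FPath (@econs_subproof e w h).

(* Inverse of [econs]: [uncons (e w) = Some (e, w)], and [uncons v = None]. *)
Definition uncons (u : fpath) : option (edge G * fpath) :=
  match u with
  | @FPath _ [::] _ => None
  | @FPath _ (e :: es) h => Some (e, @FPath (src e) es (proj2 h))
  end.

Lemma uncons_econs e w h : uncons (@econs e w h) = Some (e, w).
Proof. by congr (Some (_, _)); apply: fpath_inj. Qed.

Lemma unconsP u e w : uncons u = Some (e, w) ->
  exists h : prng w = src e, u = econs h.
Proof.
case: u => [v [//|e' es] h] /= [<- <-].
by exists erefl; apply: fpath_inj => //=; case: h.
Qed.

HB.instance Definition _ := gen_eqMixin fpath.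
HB.instance Definition _ := gen_choiceMixin fpath.

End Paths.

Section SquareSummable.
Variables (R : realType) (I : choiceType).
Implicit Types (f g : I -> R[i]).

Definition sqsum f : \bar R := \esum_(i in [set: I]) (normc (f i) ^+ 2)%:E.

Lemma sqsum_ge0 f : (0 <= sqsum f)%E.
Proof. by apply: esum_ge0 => i _; rewrite lee_fin sqr_ge0. Qed.

Lemma sqsum_ge f i : ((normc (f i) ^+ 2)%:E <= sqsum f)%E.
Proof.
apply: esum_ge; exists [set i]; last by rewrite fsbig_set1.
by split => //; exact: finite_set1.
Qed.

Lemma sqsum_scale_le (c : R) f g : 0 <= c ->
  (forall i, normc (g i) ^+ 2 = c * normc (f i) ^+ 2) ->
  (sqsum g <= c%:E * sqsum f)%E.
Proof.
move=> c0 gE; apply: ge_ereal_sup => _ [F [finF FI] <-].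
rewrite (eq_fsbigr (fun i => c%:E * (normc (f i) ^+ 2)%:E)%E); last first.
  by move=> i _; rewrite gE EFinM.
rewrite -ge0_mule_fsumr; last by move=> i; rewrite lee_fin sqr_ge0.
rewrite lee_wpmul2l ?lee_fin//; apply: ereal_sup_ubound.
by exists F.
Qed.

Lemma sqsum0 : sqsum (0 : I -> R[i]) = 0%E.
Proof. by apply: esum1 => i _; rewrite [normc _]Normc.normc0 expr0n. Qed.

Lemma normc_ge0 (z : R[i]) : 0 <= normc z.
Proof. by case: z => a b; exact: sqrtr_ge0. Qed.

Lemma sqsum_eq0 f : sqsum f = 0%E -> f = 0.
Proof.
move=> f0; apply/funext => i; apply: Normc.eq0_normc.
have := sqsum_ge f i; rewrite f0 lee_fin => h.
by apply/eqP; rewrite -sqrf_eq0 eq_le h sqr_ge0.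
Qed.

Lemma sqsumZ (c : R[i]) f :
  sqsum (c *: f) = ((normc c ^+ 2)%:E * sqsum f)%E.
Proof.
apply/eqP; rewrite eq_le; apply/andP; split.
  by apply: sqsum_scale_le; rewrite ?sqr_ge0// => i; rewrite -exprMn -Normc.normcM.
have [->|c0] := eqVneq c 0.
  by rewrite Normc.normc0 expr0n/= mul0e sqsum_ge0.
have nc0 : 0 < normc c ^+ 2.
  rewrite exprn_gt0// lt_neqAle normc_ge0 andbT eq_sym.
  by apply: contra c0 => /eqP/Normc.eq0_normc ->.
rewrite -lee_pdivlMl//; apply: sqsum_scale_le => [|i]; first by rewrite invr_ge0 ltW.
by rewrite Normc.normcM exprMn mulKf// gt_eqF.
Qed.

Lemma sqsumD_le (t : R) f g : 0 < t ->
  (sqsum (f + g)%R <= (1 + t)%:E * sqsum f + (1 + t^-1)%:E * sqsum g)%E.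
Proof.
move=> t0.
have scale (c : R) h : 0 <= c ->
    (c%:E * sqsum h = \esum_(i in [set: I]) (c * normc (h i) ^+ 2)%:E)%E.
  move=> c0; have cE : normc (Num.sqrt c)%:C ^+ 2 = c.
    by rewrite /= expr0n addr0 sqrtr_sqr ger0_norm ?sqrtr_ge0// sqr_sqrtr.
  rewrite -{1}cE -sqsumZ; apply: eq_esum => i _.
  by rewrite Normc.normcM exprMn cE.
have t1 : 0 <= 1 + t by rewrite addr_ge0// ltW.
have t1' : 0 <= 1 + t^-1 by rewrite addr_ge0// invr_ge0 ltW.
rewrite !scale// -esumD; last 2 first.
- by move=> i _; rewrite lee_fin mulr_ge0// sqr_ge0.
- by move=> i _; rewrite lee_fin mulr_ge0// sqr_ge0.
apply: le_esum => i _; rewrite -EFinD lee_fin.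
set a := normc (f i); set b := normc (g i).
have ab : normc ((f + g) i) ^+ 2 <= (a + b) ^+ 2.
  by rewrite lerXn2r ?nnegrE ?addr_ge0 ?normc_ge0// le_normcD.
apply: le_trans ab _; rewrite -subr_ge0.
suff -> : (1 + t) * a ^+ 2 + (1 + t^-1) * b ^+ 2 - (a + b) ^+ 2 =
          t^-1 * (t * a - b) ^+ 2.
  by rewrite mulr_ge0 ?sqr_ge0// invr_ge0 ltW.
by field; rewrite gt_eqF.
Qed.

Lemma sqsum_submod_closed :
  submod_closed [pred f : I -> R[i] | (sqsum f < +oo)%E].
Proof.
split=> [|c f g]; rewrite !inE ?sqsum0 ?ltry// => foo goo.
apply: le_lt_trans (sqsumD_le _ _ ltr01) _.
rewrite lte_add_pinfty// lte_mul_pinfty// ?lee_fin ?invr1 ?sqsumZ//.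
rewrite lte_mul_pinfty ?lee_fin ?sqr_ge0//.
Qed.

End SquareSummable.

Section Ell2.
Variables (R : realType) (I : choiceType).

Record ell2 := Ell2 {
  ell2_val :> I -> R[i];
  ell2_sqsum : (sqsum ell2_val < +oo)%E }.

HB.instance Definition _ := [isSub for ell2_val].
HB.instance Definition _ := [Choice of ell2 by <:].
HB.instance Definition _ := GRing.SubChoice_isSubLmodule.Build R[i] (I -> R[i])
  [pred f : I -> R[i] | (sqsum f < +oo)%E] ell2 (@sqsum_submod_closed R I).

Lemma ell2_valD (f g : ell2) : ell2_val (f + g) = ell2_val f + ell2_val g.
Proof. by []. Qed.

Lemma ell2_valZ (c : R[i]) (f : ell2) : ell2_val (c *: f) = c *: ell2_val f.
Proof. by []. Qed.

Definition ell2_norm (f : ell2) : R[i] := (Num.sqrt (fine (sqsum f)))%:C.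

Lemma sqsum_fin (f : ell2) : ((fine (sqsum f))%:E = sqsum f)%E.
Proof. by rewrite fineK// ge0_fin_numE ?sqsum_ge0//; exact: ell2_sqsum. Qed.

Lemma ell2_norm_le (f : ell2) (M : R) : 0 <= M ->
  (ell2_norm f <= M%:C) = (sqsum f <= (M ^+ 2)%:E)%E.
Proof.
move=> M0; rewrite lecR -sqsum_fin lee_fin.
by rewrite -{1}(ger0_norm M0) -sqrtr_sqr ler_sqrt// sqr_ge0.
Qed.

Lemma ell2_normD (f g : ell2) : ell2_norm (f + g) <= ell2_norm f + ell2_norm g.
Proof.
have z h : Num.sqrt (fine (sqsum (ell2_val h))) = 0 -> h = 0.
  move=> /eqP; rewrite sqrtr_eq0 => h0; apply: val_inj; apply: sqsum_eq0.
  rewrite -sqsum_fin; congr (_%:E); apply/eqP; rewrite eq_le h0.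
  by rewrite fine_ge0// sqsum_ge0.
rewrite {2 3}/ell2_norm -rmorphD.
set a := Num.sqrt _; set b := Num.sqrt _.
have [a0|a0] := eqVneq a 0; first by rewrite (z f)// add0r a0 add0r.
have [b0|b0] := eqVneq b 0; first by rewrite (z g)// addr0 b0 addr0.
have {}a0 : 0 < a by rewrite lt_neqAle eq_sym a0 sqrtr_ge0.
have {}b0 : 0 < b by rewrite lt_neqAle eq_sym b0 sqrtr_ge0.
have ab0 : 0 <= a + b by rewrite addr_ge0// ltW.
rewrite ell2_norm_le// ell2_valD.
have t0 : 0 < b / a by rewrite divr_gt0.
apply: le_trans (sqsumD_le f g t0) _.
rewrite -(sqsum_fin f) -(sqsum_fin g) -!EFinM -EFinD lee_fin.
rewrite -[fine (sqsum f)]sqr_sqrtr ?fine_ge0 ?sqsum_ge0// -/a.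
rewrite -[fine (sqsum g)]sqr_sqrtr ?fine_ge0 ?sqsum_ge0// -/b.
rewrite le_eqVlt; apply/orP; left; apply/eqP.
by field; rewrite !lt0r_neq0.
Qed.

Lemma ell2_normZ (c : R[i]) (f : ell2) : ell2_norm (c *: f) = `|c| * ell2_norm f.
Proof.
rewrite /ell2_norm -[`|c|]/((normc c)%:C) -rmorphM ell2_valZ sqsumZ fineM//; last first.
  by rewrite -sqsum_fin.
by rewrite sqrtrM ?sqr_ge0// sqrtr_sqr ger0_norm// normc_ge0.
Qed.

Lemma ell2_norm_eq0 (f : ell2) : ell2_norm f = 0 -> f = 0.
Proof.
move=> h; apply: val_inj; apply: sqsum_eq0; apply/eqP.
rewrite eq_le sqsum_ge0 andbT.
by have := ell2_norm_le f (lexx 0); rewrite h lexx expr0n/= => <-.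
Qed.

HB.instance Definition _ :=
  Lmodule_isNormed.Build R[i] ell2 ell2_normD ell2_normZ ell2_norm_eq0.

End Ell2.

Section PartialComposition.
Variables (R : realType) (I : choiceType).

Lemma sqsum_delta (w : I) : sqsum (fun i => (i == w)%:R : R[i]) = 1%E.
Proof.
rewrite -[RHS](@esum_set1 R I w (fun=> 1%E)) ?lee01// esum_mkcond.
apply: eq_esum => i _; have [->|iw] := eqVneq i w.
  by rewrite [normc _]Normc.normc1 expr1n mem_set.
rewrite [normc _]Normc.normc0 expr0n memNset//.
by move=> /eqP; rewrite (negbTE iw).
Qed.

Lemma delta_subproof (w : I) : (sqsum (fun i => (i == w)%:R : R[i]) < +oo)%E.
Proof. by rewrite sqsum_delta ltry. Qed.

Definition xi (w : I) : ell2 R I := Ell2 (delta_subproof w).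

Lemma xiE w i : xi w i = (i == w)%:R. Proof. by []. Qed.

Variable phi : I -> option I.
Hypothesis phi_inj : forall i i' j, phi i = Some j -> phi i' = Some j -> i = i'.

Definition pcomp_fun (f : I -> R[i]) : I -> R[i] :=
  fun i => if phi i is Some j then f j else 0.

Lemma sqsum_pcomp f : (sqsum (pcomp_fun f) <= sqsum f)%E.
Proof.
pose e i := odflt i (phi i).
have einj : set_inj [set i | phi i] e.
  move=> i i'; rewrite !inE /= /e; case E : (phi i) => [j|]// _.
  by case E' : (phi i') => [j'|]//= _ jj'; apply: phi_inj E _; rewrite jj'.
have n0 : ((normc (0 : R[i]) ^+ 2)%:E = 0)%E.
  by rewrite Normc.normc0 expr0n.
rewrite /sqsum [X in (X <= _)%E](_ : _ =
    \esum_(i in [set i | phi i]) (normc (f (e i)) ^+ 2)%:E)%E; last first.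
  rewrite [RHS]esum_mkcond; apply: eq_esum => i _; rewrite /pcomp_fun /e.
  case E : (phi i) => [j|].
    by rewrite mem_set//= E.
  by rewrite memNset ?n0//= E.
rewrite -(esum_image _ _ (fun j => (normc (f j) ^+ 2)%:E) einj) esum_mkcond.
apply: le_esum => i _; case: ifPn => // _.
by rewrite lee_fin sqr_ge0.
Qed.

Lemma pcomp_subproof (f : ell2 R I) : (sqsum (pcomp_fun f) < +oo)%E.
Proof. by apply: le_lt_trans (sqsum_pcomp f) _; exact: ell2_sqsum. Qed.

Definition pcomp (f : ell2 R I) : ell2 R I := Ell2 (pcomp_subproof f).

Lemma pcomp_linear : linear pcomp.
Proof.
move=> c f g; apply: val_inj; apply/funext => i.
transitivity (c * pcomp_fun f i + pcomp_fun g i); last by [].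
rewrite /= /pcomp_fun; case: (phi i) => [j|]; first by [].
by rewrite mulr0 addr0.
Qed.

Lemma pcomp_norm f : `|pcomp f| <= `|f|.
Proof.
by rewrite lecR ler_wsqrtr// fine_le ?sqsum_pcomp// -sqsum_fin.
Qed.

End PartialComposition.

Section BoundedOperators.
Variables (R : realType) (V : normedModType R[i]).

Definition bounded_linear (f : V -> V) : Prop :=
  linear f /\ exists M : R, forall x, `|f x| <= M%:C * `|x|.

Record bop := Bop {
  bop_fun :> V -> V;
  bop_bounded : `[< bounded_linear bop_fun >] }.

Lemma normcC (W : normedModType R[i]) (x : W) :
  exists2 a : R, 0 <= a & `|x| = a%:C.
Proof.
have := normr_ge0 x; case: `|x| => a b; rewrite lecE /= => /andP[/eqP -> a0].
by exists a.
Qed.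

Lemma bounded_linear_submod_closed :
  submod_closed [pred f : V -> V | `[< bounded_linear f >]].
Proof.
split=> [|c f g]; rewrite !inE.
  split=> [a x y|]; first by rewrite /= scaler0 addr0.
  by exists 0 => x; rewrite normr0 mul0r.
move=> [fl [M fM]] [gl [N gN]]; split.
  move=> a x y.
  transitivity (c *: f (a *: x + y) + g (a *: x + y)); first by [].
  by rewrite fl gl scalerDr scalerA mulrC addrACA -scalerA -scalerDr.
have [d d0 cE] : exists2 d : R, 0 <= d & `|c| = d%:C by exists (normc c); rewrite ?normc_ge0.
exists (d * M + N) => x; apply: (le_trans (ler_normD _ _)).
rewrite rmorphD rmorphM /= mulrDl lerD// normrZ cE -mulrA ler_wpM2l ?lecR//.
Qed.

HB.instance Definition _ := [isSub for bop_fun].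
HB.instance Definition _ := [Choice of bop by <:].
HB.instance Definition _ := GRing.SubChoice_isSubLmodule.Build R[i] (V -> V)
  [pred f : V -> V | `[< bounded_linear f >]] bop bounded_linear_submod_closed.

Lemma bopD (S T : bop) x : (S + T) x = S x + T x. Proof. by []. Qed.
Lemma bopZ c (T : bop) x : (c *: T) x = c *: T x. Proof. by []. Qed.
Lemma bop0 x : (0 : bop) x = 0. Proof. by []. Qed.

Lemma bopP (S T : bop) : (forall x, S x = T x) -> S = T.
Proof. by move=> h; apply: val_inj; apply/funext. Qed.

Lemma bop_linear (T : bop) : linear T.
Proof. by case: T => f /= /asboolP[]. Qed.

HB.instance Definition _ (T : bop) :=
  GRing.isLinear.Build R[i] V V *:%R T (bop_linear T).

Definition opbounds (T : bop) : set R :=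
  [set M : R | 0 <= M /\ forall x, `|T x| <= M%:C * `|x|].

Definition opnorm (T : bop) : R := inf (opbounds T).

Lemma has_inf_opbounds T : has_inf (opbounds T).
Proof.
split; last by exists 0 => M [].
case: T => f hf; have /asboolP[_ [M fM]] := hf.
exists `|M|; split=> // x /=; apply: le_trans (fM x) _.
by rewrite ler_wpM2r ?normr_ge0// lecR ler_norm.
Qed.

Lemma opnorm_ge0 T : 0 <= opnorm T.
Proof.
apply: lb_le_inf; last by move=> M [].
by have [] := has_inf_opbounds T.
Qed.

Lemma opnorm_le (T : bop) (M : R) : 0 <= M ->
  (forall x, `|T x| <= M%:C * `|x|) -> opnorm T <= M.
Proof.
by move=> M0 TM; apply: ge_inf => //; have [] := has_inf_opbounds T.
Qed.

Lemma opnormP (T : bop) x : `|T x| <= (opnorm T)%:C * `|x|.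
Proof.
have [b b0 bE] := normcC (T x); have [a a0 aE] := normcC x.
have [N0 lbN] := has_inf_opbounds T.
have bM M : opbounds T M -> b <= M * a.
  by move=> [_ /(_ x)]; rewrite aE bE -rmorphM lecR.
rewrite aE bE -rmorphM lecR.
have [a00|an0] := eqVneq a 0.
  by case: N0 => M /bM; rewrite a00 !mulr0.
have ap : 0 < a by rewrite lt_neqAle eq_sym an0.
rewrite -ler_pdivrMr//; apply: lb_le_inf => // M /bM.
by rewrite ler_pdivrMr.
Qed.

Definition bop_norm (T : bop) : R[i] := (opnorm T)%:C.

Lemma bop_normD S T : bop_norm (S + T) <= bop_norm S + bop_norm T.
Proof.
rewrite -rmorphD lecR; apply: opnorm_le.
  by rewrite addr_ge0 ?opnorm_ge0.
move=> x; rewrite bopD (le_trans (ler_normD _ _))// rmorphD mulrDl.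
by rewrite lerD ?opnormP.
Qed.

Lemma opnormZ_le c T : opnorm (c *: T) <= normc c * opnorm T.
Proof.
apply: opnorm_le; first by rewrite mulr_ge0 ?normc_ge0 ?opnorm_ge0.
move=> x; rewrite bopZ normrZ rmorphM -mulrA.
by rewrite ler_wpM2l ?opnormP// lecR normc_ge0.
Qed.

Lemma bop_normZ c T : bop_norm (c *: T) = `|c| * bop_norm T.
Proof.
rewrite -[`|c|]/((normc c)%:C) -rmorphM; congr (_%:C).
apply/eqP; rewrite eq_le opnormZ_le /=.
have [->|c0] := eqVneq c 0.
  by rewrite [normc _]Normc.normc0 mul0r opnorm_ge0.
have nc0 : 0 < normc c.
  rewrite lt_neqAle normc_ge0 andbT eq_sym.
  by apply: contra c0 => /eqP/Normc.eq0_normc ->.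
rewrite -ler_pdivlMl// -Normc.normcV.
by apply: le_trans (opnormZ_le _ _); rewrite scalerA mulVf// scale1r.
Qed.

Lemma bop_norm_eq0 T : bop_norm T = 0 -> T = 0.
Proof.
move=> T0; apply: bopP => x; apply/eqP; rewrite bop0 -normr_eq0 eq_le normr_ge0.
by rewrite andbT; have := opnormP T x; rewrite -/(bop_norm T) T0 mul0r.
Qed.

HB.instance Definition _ :=
  Lmodule_isNormed.Build R[i] bop bop_normD bop_normZ bop_norm_eq0.

Lemma bop_comp_subproof (S T : bop) : `[< bounded_linear (S \o T) >].
Proof.
apply/asboolP; split=> [c x y|]; first by rewrite /= !linearP.
exists (opnorm S * opnorm T) => x; apply: le_trans (opnormP S (T x)) _.
by rewrite rmorphM -mulrA ler_wpM2l ?opnormP// lecR opnorm_ge0.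
Qed.

Lemma bop_id_subproof : `[< bounded_linear (@idfun V) >].
Proof. by apply/asboolP; split=> //; exists 1 => x; rewrite mul1r. Qed.

Definition bop_mul (S T : bop) : bop := Bop (bop_comp_subproof S T).
Definition bop_one : bop := Bop bop_id_subproof.

Fact bop_mulA : associative bop_mul. Proof. by move=> ? ? ?; apply: bopP. Qed.
Fact bop_mul1 : left_id bop_one bop_mul. Proof. by move=> ?; apply: bopP. Qed.
Fact bop_mulr1 : right_id bop_one bop_mul. Proof. by move=> ?; apply: bopP. Qed.
Fact bop_mulDl : left_distributive bop_mul +%R.
Proof. by move=> ? ? ?; apply: bopP. Qed.
Fact bop_mulDr : right_distributive bop_mul +%R.
Proof. by move=> S T U; apply: bopP => x; exact: linearD. Qed.

HB.instance Definition _ := GRing.Zmodule_isPzRing.Build bop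
  bop_mulA bop_mul1 bop_mulr1 bop_mulDl bop_mulDr.

Lemma bopM (S T : bop) x : (S * T) x = S (T x). Proof. by []. Qed.

(* Subalgebras are not required to contain the identity operator. *)
Definition closed_subalgebra (A : set bop) : Prop :=
  [/\ submod_closed (mem A), GRing.mulr_2closed (mem A) & closed A].

End BoundedOperators.

Section GraphAlgebra.
Variables (R : realType) (G : digraph).

Local Notation HG := (ell2 R (fpath G)).

Definition edge_map (e : edge G) (u : fpath G) : option (fpath G) :=
  if uncons u is Some (e', w) then if `[< e' = e >] then Some w else None
  else None.

Definition vertex_map (x : vertex G) (u : fpath G) : option (fpath G) :=
  if `[< prng u = x >] then Some u else None.

Lemma edge_map_inj e u u' w :
  edge_map e u = Some w -> edge_map e u' = Some w -> u = u'.
Proof.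
rewrite /edge_map; case E : (uncons u) => [[e1 w1]|]//.
case: asboolP => // e1e [ww]; case E' : (uncons u') => [[e2 w2]|]//.
case: asboolP => // e2e [ww']; subst e1 e2 w1 w2.
have [h ->] := unconsP E; have [h' ->] := unconsP E'.
exact: fpath_inj.
Qed.

Lemma vertex_map_inj x u u' w :
  vertex_map x u = Some w -> vertex_map x u' = Some w -> u = u'.
Proof.
by rewrite /vertex_map; case: asboolP => // _ [->]; case: asboolP => // _ [->].
Qed.

Lemma pcomp_bounded phi phi_inj :
  `[< bounded_linear (@pcomp R (fpath G) phi phi_inj : HG -> HG) >].
Proof.
apply/asboolP; split; first exact: pcomp_linear.
by exists 1 => x; rewrite mul1r; exact: pcomp_norm.
Qed.

(* For f in l^2, (L_e f)(u) = f(w) if u = e w, and 0 if u is not of this form;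
   see [Ledge_xi] and [Ledge_xi0] for the action on the basis vectors. *)
Definition Ledge (e : edge G) : bop HG :=
  Bop (pcomp_bounded (@edge_map_inj e)).

Definition Lvertex (x : vertex G) : bop HG :=
  Bop (pcomp_bounded (@vertex_map_inj x)).

Lemma Ledge_xi e w (h : prng w = src e) : Ledge e (xi R w) = xi R (econs h).
Proof.
apply: val_inj; apply/funext => u /=; rewrite /pcomp_fun /edge_map.
case E : (uncons u) => [[e' w']|]; last first.
  by case: eqVneq => // uE; move: E; rewrite uE uncons_econs.
case: asboolP => [e'e|ne]; last first.
  by case: eqVneq => // uE; move: E; rewrite uE uncons_econs => -[] /esym/ne.
subst e'; have [h' ->] := unconsP E; congr (_%:R); congr (nat_of_bool _).
apply/eqP/eqP => [ww|/(congr1 (@uncons G))].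
  by apply: fpath_inj; rewrite //= ww.
by rewrite !uncons_econs => -[].
Qed.

Lemma Ledge_xi0 e w : prng w <> src e -> Ledge e (xi R w) = 0.
Proof.
move=> h; apply: val_inj; apply/funext => u /=; rewrite /pcomp_fun /edge_map.
case E : (uncons u) => [[e' w']|]//; case: asboolP => // e'e; subst e'.
have [h' _] := unconsP E; rewrite /=; case: eqVneq => // ww.
by case: h; rewrite -ww.
Qed.

Lemma Lvertex_xi x w : prng w = x -> Lvertex x (xi R w) = xi R w.
Proof.
move=> h; apply: val_inj; apply/funext => u /=; rewrite /pcomp_fun /vertex_map.
case: asboolP => //= ux; case: eqVneq => // uw.
by case: ux; rewrite uw.
Qed.

Lemma Lvertex_xi0 x w : prng w <> x -> Lvertex x (xi R w) = 0.
Proof.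
move=> h; apply: val_inj; apply/funext => u /=; rewrite /pcomp_fun /vertex_map.
case: asboolP => //= ux; case: eqVneq => // uw.
by case: h; rewrite -uw.
Qed.

Definition graph_algebra : set (bop HG) :=
  smallest (@closed_subalgebra R HG) (range Ledge `|` range Lvertex).

Lemma graph_algebra_closed : closed_subalgebra graph_algebra.
Proof.
split.
- split=> [|c A B]; rewrite !inE.
    by move=> X [[[X0 _] _ _] _]; move: X0; rewrite inE.
  move=> hA hB X hX.
  have [[[_ Xl] _ _] _] := hX.
  by have := Xl c A B (mem_set (hA X hX)) (mem_set (hB X hX)); rewrite inE.
- move=> A B; rewrite !inE => hA hB X hX; have [[_ Xm _] _] := hX.
  by have := Xm A B (mem_set (hA X hX)) (mem_set (hB X hX)); rewrite inE.
- by apply: closed_bigI => X [[_ _]].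
Qed.

Record galg := GAlg {
  galg_op :> bop HG;
  galg_mem : galg_op \in graph_algebra }.

HB.instance Definition _ := [isSub for galg_op].
HB.instance Definition _ := [Choice of galg by <:].

Lemma galg_submod_closed : submod_closed [pred A | A \in graph_algebra].
Proof. by case: graph_algebra_closed. Qed.

HB.instance Definition _ := GRing.SubChoice_isSubLmodule.Build R[i] (bop HG)
  [pred A | A \in graph_algebra] galg galg_submod_closed.

Definition galg_norm (A : galg) : R[i] := `|galg_op A|.

Fact galg_normD A B : galg_norm (A + B) <= galg_norm A + galg_norm B.
Proof. exact: ler_normD. Qed.

Fact galg_normZ c A : galg_norm (c *: A) = `|c| * galg_norm A.
Proof. exact: normrZ. Qed.

Fact galg_norm_eq0 A : galg_norm A = 0 -> A = 0.
Proof. by move=> A0; apply: val_inj; exact: normr0_eq0. Qed.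

HB.instance Definition _ :=
  Lmodule_isNormed.Build R[i] galg galg_normD galg_normZ galg_norm_eq0.

Lemma galg_mul_subproof (A B : galg) :
  galg_op A * galg_op B \in graph_algebra.
Proof. by case: graph_algebra_closed => _ + _; apply; exact: galg_mem. Qed.

Definition galg_mul (A B : galg) : galg := GAlg (galg_mul_subproof A B).

Definition derivation (d : galg -> galg) : Prop :=
  linear d /\
  forall A B, d (galg_mul A B) = galg_mul (d A) B + galg_mul A (d B).

Definition bounded_map (d : galg -> galg) : Prop :=
  exists M : R, forall A, `|d A| <= M%:C * `|A|.

Definition inner_derivation (T A : galg) : galg := galg_mul A T - galg_mul T A.

Definition inner (d : galg -> galg) : Prop := exists T, d = inner_derivation T.

End GraphAlgebra.

(* Main.v *)
Require Import Defs.
From mathcomp Require Import all_boot classical_sets cardinality reals.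
From Stdlib Require Import Relations.
From mathcomp Require Import all_order all_algebra complex.
From mathcomp Require Import boolp functions ereal normedtype.

(** Let [S] be a set of vertices and let [D] be the projection of l^2 onto the
    span of the paths with range in [S], that is, the strong sum of the [L_x] for
    [x] in [S].  Then [D] commutes with every [L_x], and the commutator
    [L_e D - D L_e] is the multiple [1_S(s(e)) - 1_S(r(e))] of [L_e].  Since the
    operators of the algebra whose commutator with [D] stays in the algebra form
    a closed subalgebra ([commutator_graph_algebra]), the map [A |-> A D - D A]
    is a derivation of the whole algebra, bounded by twice the norm of [D].

    To see when it is inner, look at the diagonal of operators.  An operator
    built from the [L_e] and [L_x] never shortens paths, and its diagonal
    coefficient at a path [w] depends on the range of [w] only; this defines its
    symbol, a function on the vertices.  The symbol is multiplicative, is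
    dominated by the operator norm, vanishes for [L_e], and is a point mass for
    [L_x].  Hence every element of the algebra has a symbol that tends to [0] at
    infinity ([graph_algebra_symbol]), while the symbol of [D] is [1_S].

    The coefficient of [L_e A - A L_e] that takes the vertex [s(e)] to the path
    [e] is the difference of the values of the symbol of [A] at [s(e)] and at
    [r(e)] ([commutator_Ledge_coord]).  So if [T] in the algebra, of symbol [t],
    implements the same derivation as [D], then [t - 1_S] takes the same value
    at both ends of every edge, and is a constant [c] since the graph is
    connected.  As there are infinitely many vertices, [S] can be chosen
    infinite with infinite complement; [t] is [c + 1] on [S] and [c] off [S],
    and it tends to [0] at infinity, so [c + 1 = 0] and [c = 0], which is
    absurd. *)

Set Implicit Arguments.
Unset Strict Implicit.
Unset Printing Implicit Defensive.

Import Order.TTheory GRing.Theory Num.Theory.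

(* Restores the type of directed paths, hidden by the notation [fpath f] for
   the trajectories of a function. *)
Local Notation fpath := Defs.fpath.
Local Open Scope complex_scope.
Local Open Scope ring_scope.
Local Open Scope classical_set_scope.

Local Notation normc := Normc.normc.

(** * Topological and set-theoretic preliminaries *)

Lemma closed_approxP (R : realType) (V : normedModType R[i]) (X : set V) :
  closed X <-> forall x,
    (forall e : R, 0 < e -> exists2 y, X y & `|x - y| <= e%:C) -> X x.
Proof.
split=> [clX x xX|XX x xX].
  apply: clX => B /nbhs_ballP[[a b] /=].
  rewrite ltcE /= => /andP[/eqP -> a0] aB.
  have [y Xy xy] := xX (a / 2) (divr_gt0 a0 (ltr0n _ 2)).
  exists y; split=> //; apply: aB; rewrite -ball_normE /=.
  by apply: le_lt_trans xy _; rewrite ltcR ltr_pdivrMr// mulr_natr mulr2n ltrDl.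
apply: XX => e e0.
have [|y [Xy /=]] := xX (ball x e%:C).
  by apply: nbhsx_ballx; rewrite ltcR.
by rewrite -ball_normE /= => /ltW xy; exists y.
Qed.

(** An infinite type contains a copy of the natural numbers; the copy of the
    even ones is such a subset, the odd ones lying in its complement. *)
Lemma infinite_coinfinite_subset (T : Type) : infinite_set [set: T] ->
  exists S : set T, infinite_set S /\ infinite_set (~` S).
Proof.
move=> /infiniteP/card_leP/unsquash f.
have nat_inf : infinite_set [set: nat] by exact: infinite_nat.
pose g (k : nat) : T := val (f (exist _ k (mem_set I))).
have ginj : injective g.
  move=> a b /val_inj fab; have := @inj _ _ _ f _ _ (mem_set I) (mem_set I) fab.
  by move=> [].
pose h := fun k : nat => g k.*2; pose h' := fun k : nat => g k.*2.+1.
have infh (k : nat -> T) : injective k -> infinite_set (range k).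
  by move=> kinj; rewrite (eq_finite_set (inj_card_eq (in2W kinj))).
exists (range h); split.
  by apply: infh => a b /ginj/double_inj.
apply: sub_infinite_set (infh h' _).
  move=> _ [a _ <-] [b _ /ginj] ab.
  by have := congr1 odd ab; rewrite /= !odd_double.
by move=> a b /ginj [] /double_inj.
Qed.

(** * Norm estimates *)

Section Coordinates.
Variables (R : realType) (I : choiceType).
Implicit Types (f : ell2 R I).

Lemma ell2_coord_le f i : `|f i| <= `|f|.
Proof.
rewrite lecR -[leLHS]ger0_norm ?normc_ge0// -sqrtr_sqr ler_wsqrtr//.
by rewrite -lee_fin sqsum_fin sqsum_ge.
Qed.

Lemma norm_xi (w : I) : `|xi R w| = 1.
Proof. by rewrite [`|_|]/(ell2_norm _) /ell2_norm sqsum_delta/= sqrtr1. Qed.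

End Coordinates.

Section OperatorNorm.
Variables (R : realType) (V : normedModType R[i]).
Implicit Types (A B : bop V).

Lemma bop_norm_apply A x : `|A x| <= `|A| * `|x|.
Proof. exact: opnormP. Qed.

Lemma bop_normM A B : `|A * B| <= `|A| * `|B|.
Proof.
rewrite /Num.norm /= /bop_norm -rmorphM lecR; apply: opnorm_le.
  by rewrite mulr_ge0 ?opnorm_ge0.
move=> x; apply: le_trans (opnormP A _) _.
by rewrite rmorphM -mulrA ler_wpM2l ?opnormP// lecR opnorm_ge0.
Qed.

End OperatorNorm.

(** * The symbol of an operator *)

Section Symbol.
Variables (R : realType) (G : digraph).

Local Notation HG := (ell2 R (fpath G)).
Local Notation V := (vertex G).
Implicit Types (A B : bop HG) (f g : HG) (u w : fpath G) (t : V -> R[i]).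

Definition vanishes_below (n : nat) f :=
  forall u, (size (pedges u) < n)%N -> f u = 0.

(** Says at once that [A] does not shorten paths, that it is diagonal to leading
    order, and that its diagonal coefficient at [w] is [t] at the range of [w].
    Testing against all vectors [f] rather than basis vectors makes stability
    under products immediate, without expanding [B f] in the basis. *)
Definition has_symbol t A := forall f w,
  vanishes_below (size (pedges w)) f -> A f w = t (prng w) * f w.

Definition symbol A (x : V) : R[i] := A (xi R (vpath x)) (vpath x).

Lemma has_symbolE t A : has_symbol t A -> symbol A = t.
Proof.
move=> At; apply/funext => x.
by rewrite /symbol At ?xiE ?eqxx ?mulr1.
Qed.

Lemma ell2E (c : R[i]) f g u : (c *: f + g) u = c * f u + g u.
Proof. by []. Qed.

Lemma LedgeE e f u :
  Ledge R e f u = if edge_map e u is Some w then f w else 0.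
Proof. by []. Qed.

Lemma LvertexE x f u : Lvertex R x f u = `[< prng u = x >]%:R * f u.
Proof.
rewrite /= /pcomp_fun /vertex_map.
by case: asboolP; rewrite ?mul1r ?mul0r.
Qed.

Lemma has_symbolP c t s A B : has_symbol t A -> has_symbol s B ->
  has_symbol (fun x => c * t x + s x) (c *: A + B).
Proof.
move=> At Bs f w fw.
by rewrite bopD bopZ ell2E (At _ _ fw) (Bs _ _ fw) mulrDl mulrA.
Qed.

(** If [f] vanishes on the paths shorter than [w], then so does [B f], because
    [B] has a symbol; so the symbol of [A] governs the value of [A (B f)] at
    [w]. *)
Lemma has_symbolM t s A B : has_symbol t A -> has_symbol s B ->
  has_symbol (fun x => t x * s x) (A * B).
Proof.
move=> At Bs f w fw.
rewrite bopM At ?(Bs _ _ fw) ?mulrA// => u uw.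
rewrite Bs ?fw ?mulr0// => v vu; apply: fw; exact: ltn_trans vu uw.
Qed.

Lemma bop_coord_le A f u : `|A f u| <= `|A| * `|f|.
Proof. exact: le_trans (ell2_coord_le _ _) (bop_norm_apply _ _). Qed.

Lemma symbol_le A x : `|symbol A x| <= `|A|.
Proof. by rewrite -[leRHS]mulr1 -(norm_xi R (vpath x)) bop_coord_le. Qed.

Lemma bop_coordB A B f u : (A - B) f u = A f u - B f u.
Proof. by []. Qed.

Lemma symbolB A B x : symbol (A - B) x = symbol A x - symbol B x.
Proof. by []. Qed.

(** [L_e] lengthens every path, so it has nothing on the diagonal. *)
Lemma has_symbol_Ledge e : has_symbol (fun=> 0) (Ledge R e).
Proof.
move=> f w fw; rewrite mul0r LedgeE /edge_map.
case E : (uncons w) => [[e' u]|]//; case: asboolP => // _.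
by have [h wE] := unconsP E; apply: fw; rewrite wE.
Qed.

Lemma has_symbol_Lvertex x :
  has_symbol (fun y => `[< y = x >]%:R) (Lvertex R x).
Proof. by move=> f w _; exact: LvertexE. Qed.

Definition null_at_infinity t :=
  forall e : R, 0 < e -> finite_set [set x | e <= normc (t x)].

Lemma null_at_infinity_finite_support t (F : set V) : finite_set F ->
  (forall x, ~ F x -> t x = 0) -> null_at_infinity t.
Proof.
move=> finF tF e e0; apply: sub_finite_set finF => x /= ex.
have [//|/tF tx] := pselect (F x).
by move: ex; rewrite tx Normc.normc0 leNgt e0.
Qed.

Lemma null_at_infinityP c t s : null_at_infinity t -> null_at_infinity s ->
  null_at_infinity (fun x => c * t x + s x).
Proof.
move=> t0 s0 e e0.
have c1 : 0 < normc c + 1 by rewrite ltr_wpDl// normc_ge0.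
have e2 : 0 < e / 2 by rewrite divr_gt0.
apply: (@sub_finite_set _ _ ([set x | e / 2 / (normc c + 1) <= normc (t x)]
  `|` [set x | e / 2 <= normc (s x)])); last first.
  by rewrite finite_setU; split; [apply: t0; rewrite divr_gt0|exact: s0].
move=> x /= ex; have [|sx] := leP (e / 2) (normc (s x)); first by right.
left; rewrite ler_pdivrMr//.
have : e / 2 < normc (c * t x).
  rewrite -(ltrD2r (e / 2)) -splitr (le_lt_trans ex)//.
  by rewrite (le_lt_trans (le_normcD _ _))// ltrD2l.
move=> /ltW /le_trans; apply.
by rewrite Normc.normcM mulrC ler_wpM2l ?normc_ge0// lerDl.
Qed.

Lemma null_at_infinityM t s (M : R) : (forall x, normc (t x) <= M) ->
  null_at_infinity s -> null_at_infinity (fun x => t x * s x).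
Proof.
move=> tM s0 e e0.
have M1 : 0 < `|M| + 1 by rewrite ltr_wpDl.
apply: (@sub_finite_set _ _ [set x | e / (`|M| + 1) <= normc (s x)]); last first.
  by apply: s0; rewrite divr_gt0.
move=> x /= ex; rewrite ler_pdivrMr// (le_trans ex)// Normc.normcM mulrC.
rewrite ler_wpM2l ?normc_ge0// (le_trans (tM x))// (le_trans (ler_norm _))//.
by rewrite lerDl.
Qed.

Definition symbol_algebra : set (bop HG) :=
  [set A | has_symbol (symbol A) A /\ null_at_infinity (symbol A)].

Lemma symbol_algebraP t A : has_symbol t A -> null_at_infinity t ->
  symbol_algebra A.
Proof. by move=> At t0; split; rewrite (has_symbolE At). Qed.

(** Both the symbol and the coordinates of [A f] are continuous in [A], by
    [symbol_le] and [bop_coord_le]; the convergence of the symbols is uniform,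
    which preserves the limit [0] at infinity. *)
Lemma closed_symbol_algebra : closed symbol_algebra.
Proof.
apply/closed_approxP => A AX; split.
  move=> f w fw; apply/eqP; rewrite -subr_eq0 -normr_eq0.
  have [a a0 fE] := normcC f.
  set z := _ - _; suff : normc z <= 0.
    by move=> z0; rewrite -[`|z|]/((normc z)%:C) eq_le !lecR z0 normc_ge0.
  apply/ler_addgt0Pl => e e0; rewrite addr0.
  (* [z] is linear in the operator, zero for [B], and bounded by [2 |f|] times
     the norm; adding [1] keeps the denominator positive when [f] is zero. *)
  have d0 : 0 < e / (a + a + 1) by rewrite divr_gt0// ltr_wpDl// addr_ge0.
  have [B [Bs _] AB] := AX _ d0.
  have zE : z = (A - B) f w - symbol (A - B) (prng w) * f w.
    by rewrite bop_coordB symbolB (Bs _ _ fw) /z mulrBl opprB addrA subrK.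
  have : `|z| <= (e / (a + a + 1) * (a + a))%:C.
    rewrite zE (le_trans (ler_normB _ _))//.
    rewrite mulrDr rmorphD lerD//.
      rewrite (le_trans (bop_coord_le _ _ _))// fE rmorphM.
      by rewrite ler_wpM2r// lecR.
    rewrite normrM rmorphM ler_pM//.
      exact: le_trans (symbol_le _ _) AB.
    by rewrite /= -fE ell2_coord_le.
  rewrite lecR => /le_trans; apply.
  by rewrite mulrAC ler_pdivrMr ?ltr_wpDl ?addr_ge0// ler_wpM2l ?(ltW e0)// lerDl.
move=> e e0; have e2 : 0 < e / 2 by rewrite divr_gt0.
have [B [_ B0] AB] := AX _ e2.
apply: sub_finite_set (B0 _ e2) => x /= ex.
rewrite -(lerD2l (e / 2)) -splitr (le_trans ex)//.
rewrite -[symbol A x](subrK (symbol B x)) (le_trans (le_normcD _ _))// lerD2r.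
by rewrite -lecR (le_trans _ AB)// -symbolB symbol_le.
Qed.

Lemma symbol_algebra_closed : closed_subalgebra symbol_algebra.
Proof.
split; last exact: closed_symbol_algebra.
- split=> [|c A B]; rewrite !inE.
    apply: (@symbol_algebraP (fun=> 0)) => [f w _|].
      by rewrite bop0 mul0r.
    exact: (@null_at_infinity_finite_support _ set0).
  move=> [As A0] [Bs B0]; apply: symbol_algebraP (has_symbolP c As Bs) _.
  exact: null_at_infinityP.
- move=> A B; rewrite !inE => -[As A0] [Bs B0].
  apply: symbol_algebraP (has_symbolM As Bs) _.
  apply: (@null_at_infinityM _ _ (opnorm A)) => // x.
  by rewrite -lecR; exact: symbol_le.
Qed.

(** This is where infinitely many vertices matter: the symbols form a subspace
    that contains no nonzero constant. *)
Lemma graph_algebra_symbol A : (@graph_algebra R G) A -> symbol_algebra A.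
Proof.
apply: smallest_sub; first exact: symbol_algebra_closed.
move=> _ [[e _ <-]|[x _ <-]].
  apply: symbol_algebraP (has_symbol_Ledge e) _.
  exact: (@null_at_infinity_finite_support _ set0).
apply: symbol_algebraP (has_symbol_Lvertex x) _.
apply: (@null_at_infinity_finite_support _ [set x]) => // y.
by case: asboolP.
Qed.

(** The symbol is read off at the vertex [s(e)], a path of length [0], in the
    first product, and at the path [e], whose range is [r(e)], in the second. *)
Lemma commutator_Ledge_coord t A e : has_symbol t A ->
  (Ledge R e * A - A * Ledge R e) (xi R (vpath (src e)))
    (econs (erefl : prng (vpath (src e)) = src e)) = t (src e) - t (rng e).
Proof.
move=> At; rewrite bop_coordB !bopM Ledge_xi; congr (_ - _).
  transitivity (A (xi R (vpath (src e))) (vpath (src e))); last first.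
    by rewrite At// xiE eqxx mulr1.
  rewrite LedgeE /edge_map /=; case: asboolP => // _.
  by congr (A _ _); apply: fpath_inj.
rewrite At ?xiE ?eqxx ?mulr1// => u uw.
by rewrite xiE; case: eqVneq => // uE; move: uw; rewrite uE ltnn.
Qed.

End Symbol.

(** * Commutators that preserve the graph algebra *)

Section Commutator.
Variables (R : realType) (G : digraph).

Local Notation HG := (ell2 R (fpath G)).
Local Notation V := (vertex G).
Local Notation AG := (@graph_algebra R G).
Implicit Types (A B D : bop HG) (S : set V).

Lemma commutatorM A B D :
  (A * B) * D - D * (A * B) = A * (B * D - D * B) + (A * D - D * A) * B.
Proof. by rewrite mulrBr mulrBl !mulrA addrA subrK. Qed.

Lemma commutatorP (c : R[i]) A B D :
  (c *: A + B) * D - D * (c *: A + B) = c *: (A * D - D * A) + (B * D - D * B).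
Proof.
have Zl : (c *: A) * D = c *: (A * D) by exact: bopP.
have Zr : D * (c *: A) = c *: (D * A).
  by apply: bopP => x; rewrite bopM !bopZ linearZ.
by rewrite mulrDl mulrDr Zl Zr scalerBr opprD addrACA.
Qed.

Lemma commutator_norm_le A D :
  `|A * D - D * A| <= (opnorm D + opnorm D)%:C * `|A|.
Proof.
rewrite (le_trans (ler_normB _ _))// rmorphD mulrDl lerD ?bop_normM//.
by rewrite mulrC bop_normM.
Qed.

(** Membership of [A] itself is part of the definition because the products in
    [commutatorM] involve [A] and [B] besides their commutators. *)
Definition stabilizer D : set (bop HG) :=
  [set A | AG A /\ AG (A * D - D * A)].

(** The product rule gives stability under products; closedness holds because
    [A |-> A D - D A] is bounded and the graph algebra is closed. *)
Lemma stabilizer_closed D : closed_subalgebra (stabilizer D).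
Proof.
have [[AG0 AGP] AGM AGcl] := graph_algebra_closed R G.
rewrite !inE in AG0.
have AGP' c A B : AG A -> AG B -> AG (c *: A + B).
  by move=> hA hB; rewrite -in_setE; apply: AGP; rewrite inE.
have AGM' A B : AG A -> AG B -> AG (A * B).
  by move=> hA hB; rewrite -in_setE; apply: AGM; rewrite inE.
split.
- split=> [|c A B]; rewrite !inE.
    by split; rewrite ?mul0r ?mulr0 ?subrr.
  move=> [hA dA] [hB dB]; split; first exact: AGP'.
  by rewrite commutatorP; exact: AGP'.
- move=> A B; rewrite !inE => -[hA dA] [hB dB]; split; first exact: AGM'.
  rewrite commutatorM -[X in AG (X + _)]scale1r.
  by apply: AGP'; exact: AGM'.
- apply/closed_approxP => A AX; split.
    apply: (closed_approxP _).1 AGcl _ _ => e e0.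
    by have [B [hB _] AB] := AX _ e0; exists B.
  apply: (closed_approxP _).1 AGcl _ _ => e e0.
  pose M := opnorm D + opnorm D.
  have M0 : 0 <= M by rewrite addr_ge0 ?opnorm_ge0.
  have d0 : 0 < e / (M + 1) by rewrite divr_gt0// ltr_wpDl.
  have [B [_ hB] AB] := AX _ d0; exists (B * D - D * B) => //.
  have -> : A * D - D * A - (B * D - D * B) = (A - B) * D - D * (A - B).
    by rewrite mulrBl mulrBr !opprB addrACA [RHS]addrACA (addrC (- (D * A))).
  rewrite (le_trans (commutator_norm_le _ _))// -/M.
  apply: (@le_trans _ _ (M * (e / (M + 1)))%:C).
    by rewrite rmorphM ler_wpM2l// lecR.
  by rewrite lecR mulrCA ler_piMr ?(ltW e0)// ler_pdivrMr ?ltr_wpDl// mul1r lerDl.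
Qed.

Lemma commutator_graph_algebra D :
  (forall e, AG (Ledge R e * D - D * Ledge R e)) ->
  (forall x, AG (Lvertex R x * D - D * Lvertex R x)) ->
  forall A, AG A -> AG (A * D - D * A).
Proof.
move=> De Dx; suff sub : AG `<=` stabilizer D by move=> A /sub[].
apply: smallest_sub; first exact: stabilizer_closed.
by move=> _ [[e _ <-]|[x _ <-]]; split=> //; apply: sub_gen_smallest;
  [left; exists e|right; exists x].
Qed.

Definition vertices_map S (u : fpath G) : option (fpath G) :=
  if `[< S (prng u) >] then Some u else None.

Lemma vertices_map_inj S u u' w :
  vertices_map S u = Some w -> vertices_map S u' = Some w -> u = u'.
Proof.
by rewrite /vertices_map; case: asboolP => // _ [->]; case: asboolP => // _ [->].
Qed.

(** The strongly convergent sum of the [L_x] for [x] in [S]; it is outside the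
    graph algebra when [S] is infinite. *)
Definition Lvertices S : bop HG :=
  Bop (pcomp_bounded R (@vertices_map_inj S)).

Lemma LverticesE S f u : Lvertices S f u = `[< S (prng u) >]%:R * f u.
Proof.
rewrite /= /pcomp_fun /vertices_map.
by case: asboolP; rewrite ?mul1r ?mul0r.
Qed.

Lemma has_symbol_Lvertices S :
  has_symbol (fun x => `[< S x >]%:R) (Lvertices S).
Proof. by move=> f w _; exact: LverticesE. Qed.

Lemma commutator_Ledge_Lvertices S e :
  Ledge R e * Lvertices S - Lvertices S * Ledge R e =
  (`[< S (src e) >]%:R - `[< S (rng e) >]%:R) *: Ledge R e.
Proof.
apply: bopP => f; apply: val_inj; apply/funext => u.
transitivity (Ledge R e (Lvertices S f) u - Lvertices S (Ledge R e f) u).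
  by [].
rewrite LverticesE bopZ.
transitivity ((`[< S (src e) >]%:R - `[< S (rng e) >]%:R) * Ledge R e f u);
  last by [].
rewrite !LedgeE /edge_map; case E : (uncons u) => [[e' w]|]; last first.
  by rewrite !mulr0 subrr.
case: asboolP => [ee|_]; last by rewrite !mulr0 subrr.
have [h uE] := unconsP E; rewrite {}ee in h uE *.
by rewrite uE LverticesE h mulrBl.
Qed.

Lemma commutator_Lvertex_Lvertices S x :
  Lvertex R x * Lvertices S - Lvertices S * Lvertex R x = 0.
Proof.
apply: bopP => f; apply: val_inj; apply/funext => u.
transitivity (Lvertex R x (Lvertices S f) u - Lvertices S (Lvertex R x f) u).
  by [].
by rewrite !(LverticesE, LvertexE) mulrCA subrr.
Qed.

Lemma commutator_Lvertices_graph_algebra S A :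
  AG A -> AG (A * Lvertices S - Lvertices S * A).
Proof.
have [[AG0 AGP] _ _] := graph_algebra_closed R G; rewrite inE in AG0.
apply: commutator_graph_algebra => [e|x]; last by rewrite commutator_Lvertex_Lvertices.
rewrite commutator_Ledge_Lvertices -[_ *: _]addr0 -in_setE.
by apply: AGP; rewrite inE//; apply: sub_gen_smallest; left; exists e.
Qed.

End Commutator.

(** * A bounded outer derivation *)

Section OuterDerivation.
Variables (R : realType) (G : digraph) (S : set (vertex G)).

Lemma vertices_derivation_subproof (A : galg R G) :
  galg_op A * Lvertices R S - Lvertices R S * galg_op A \in @graph_algebra R G.
Proof.
by rewrite inE; apply: commutator_Lvertices_graph_algebra; rewrite -in_setE galg_mem.
Qed.

Definition vertices_derivation (A : galg R G) : galg R G :=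
  GAlg (vertices_derivation_subproof A).

Lemma vertices_derivation_is_derivation : derivation vertices_derivation.
Proof.
split=> [c A B|A B]; apply: val_inj; first exact: commutatorP.
by rewrite /= commutatorM addrC.
Qed.

Lemma vertices_derivation_bounded : bounded_map vertices_derivation.
Proof.
exists (opnorm (Lvertices R S) + opnorm (Lvertices R S)) => A.
exact: commutator_norm_le.
Qed.

End OuterDerivation.

Theorem lemma5p7 (R : realType) (G : digraph)
    (G_connected : graph_connected G)
    (G_infinite : infinite_set [set: vertex G]) :
  exists d : galg R G -> galg R G,
    [/\ derivation d, bounded_map d & ~ inner d].
Proof.
have [S [Sinf cSinf]] := infinite_coinfinite_subset G_infinite.
exists (@vertices_derivation R G S); split.
- exact: vertices_derivation_is_derivation.
- exact: vertices_derivation_bounded.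
move=> [T dT].
pose chi x : R[i] := `[< S x >]%:R.
have [Ts T0] : symbol_algebra (galg_op T).
  by apply: graph_algebra_symbol; rewrite -in_setE galg_mem.
set t := symbol _ in Ts T0.
have edge_diff e : t (src e) - chi (src e) = t (rng e) - chi (rng e).
  have Lmem : Ledge R e \in @graph_algebra R G.
    by rewrite inE; apply: sub_gen_smallest; left; exists e.
  have LT : Ledge R e * Lvertices R S - Lvertices R S * Ledge R e =
            Ledge R e * galg_op T - galg_op T * Ledge R e.
    exact: (congr1 (fun d => galg_op (d (GAlg Lmem))) dT).
  have := commutator_Ledge_coord e (@has_symbol_Lvertices R G S).
  rewrite LT (commutator_Ledge_coord e Ts) => /eqP.
  rewrite subr_eq -/(chi _) -/(chi _) => /eqP ->.
  by rewrite addrAC (addrAC (chi _)) subrr add0r addrC.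
have diff_const x y : t x - chi x = t y - chi y.
  elim: (G_connected x y) => {x y}[x y [e [<- <-]]|//|x y _ ->//|x y z _ -> _ ->//].
  exact: edge_diff.
have [x0 _] := infinite_setN0 G_infinite.
pose c := t x0 - chi x0.
have tE x : t x = c + chi x by rewrite /c (diff_const x0 x) subrK.
(* [t] tends to [0] at infinity, so [0] is its only possible constant value on
   an infinite set. *)
have const_zero (b : R[i]) (U : set (vertex G)) :
    infinite_set U -> (forall x, U x -> t x = b) -> b = 0.
  move=> Uinf tU; apply: Normc.eq0_normc; apply/eqP; rewrite eq_le normc_ge0 andbT.
  rewrite leNgt; apply/negP => b0; apply: Uinf.
  by apply: sub_finite_set (T0 _ b0) => x /tU /= ->.
have c0 : c = 0.
  apply: (const_zero _ _ cSinf) => x nSx; rewrite tE /chi.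
  by case: asboolP => // _; rewrite addr0.
have : c + 1 = 0.
  by apply: (const_zero _ _ Sinf) => x Sx; rewrite tE /chi asboolT.
by rewrite c0 add0r => /eqP; rewrite oner_eq0.
Qed.
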